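(* Let $G$ be a graph on $n$ vertices, $\ell$ a positive integer, and $M\subseteq V(G)$ with $|M|=k$ such that $Q=G-M$ is a clique, and assume $n\le\ell+k$. Let $C=\{c_1,\dots,c_\ell\}$, $C'=\{c'_v:v\in M\}$, and $V'$ a set of $\ell+k-n$ new (artificial) vertices. Let $B$ be the bipartite graph with bipartition $(V(G)\cup V',\,C\cup C')$ in which every $v\in V(G)$ is adjacent to all of $C$, each $v\in M$ is additionally adjacent to $c'_v$, and every vertex of $V'$ is adjacent to all of $C\cup C'$. For each edge $(v,c)$ of $B$ define $\mathcal{S}_{(v,c)}\subseteq 2^M$: if $v\in V(Q)$, $c\in C$, it consists of all $S\subseteq M$ such that $S\cup\{v\}$ is independent in $G$ and some $u\in V(G)$ has $N_G[u]\supseteq S\cup\{v\}$; if $v\in M$, $c\in C$, it consists of all independent $S\subseteq M$ with $v\in S$ such that some $u\in V(G)$ has $N_G[u]\supseteq S$; if $v\in V'$ or $c\in C'$, $\mathcal{S}_{(v,c)}=\{\emptyset\}$. With variables $x_u$ ($u\in M$) and $z_{(v,c)}$ (edges of $B$), let $P(v,c)=\sum_{S\in\mathcal{S}_{(v,c)}}\prod_{s\in S}x_s$ (empty product $=1$) and let $A$ be the square matrix with rows indexed by $V(G)\cup V'$, columns by $C\cup C'$, $A(v,c)=z_{(v,c)}P(v,c)$ for $(v,c)\in E(B)$ and $0$ otherwise. Then $G$ has a CD coloring with at most $\ell$ colors if and only if $\det A$ (a polynomial over $\mathbb{R}$) contains a monomial divisible by $\prod_{u\in M}x_u$.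
   Context: Graphs are finite and simple; $N_G[v]=N_G(v)\cup\{v\}$. A proper coloring assigns different colors to adjacent vertices. A vertex $v$ dominates a set $T$ if $T\subseteq N_G[v]$. A CD coloring of $G$ is a proper coloring in which every color class is dominated by some vertex of $G$. *)

(* Defs.v *)
(* A finite simple graph on the vertex type [V] is a symmetric
   irreflexive [e : rel V]. *)
From mathcomp Require Import all_boot all_order all_algebra.
From mathcomp Require Import reals.
From mathcomp Require Import mpoly.

Set Implicit Arguments.
Unset Strict Implicit.
Unset Printing Implicit Defensive.

Import GRing.Theory.
Local Open Scope ring_scope.

Definition closed_nbhd (V : finType) (e : rel V) (v : V) : {set V} :=
  v |: [set u | e v u].

Definition dominates (V : finType) (e : rel V) (v : V) (S : {set V}) : bool :=
  S \subset closed_nbhd e v.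

Definition independent (V : finType) (e : rel V) (S : {set V}) : bool :=
  [forall u in S, forall v in S, ~~ e u v].

Definition clique (V : finType) (e : rel V) (S : {set V}) : Prop :=
  {in S &, forall u v, u != v -> e u v}.

Definition proper_coloring (V : finType) (e : rel V) (K : eqType)
    (f : V -> K) : Prop :=
  forall u v, e u v -> f u != f v.

(* Only the nonempty color classes have to be dominated. *)
Definition CD_coloring (V : finType) (e : rel V) (K : eqType)
    (f : V -> K) : Prop :=
  proper_coloring e f /\
  forall c : K, c \in codom f -> exists v, dominates e v [set w | f w == c].

Definition CD_colorable (V : finType) (e : rel V) (l : nat) : Prop :=
  exists f : V -> 'I_l, CD_coloring e f.

(* V(G) together with the artificial vertices V' *)
Definition Brow (V : finType) (M : {set V}) (l : nat) : finType :=
  (V + 'I_(l + #|M| - #|V|))%type.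

(* C together with C' *)
Definition Bcol (V : finType) (M : {set V}) (l : nat) : finType :=
  ('I_l + {u : V | u \in M})%type.

Definition Badj (V : finType) (M : {set V}) (l : nat)
    (p : Brow M l * Bcol M l) : bool :=
  match p with
  | (inl _, inl _) => true
  | (inl v, inr w) => v == val w
  | (inr _, _) => true
  end.

Definition Bedge (V : finType) (M : {set V}) (l : nat) : finType :=
  {p : Brow M l * Bcol M l | Badj p}.

Definition edge_family (V : finType) (e : rel V) (M : {set V}) (l : nat)
    (p : Brow M l * Bcol M l) : {set {set V}} :=
  match p with
  | (inl v, inl _) =>
      if v \in M then
        [set S : {set V} | [&& S \subset M, independent e S, v \in S
                             & [exists u, dominates e u S]]]
      else
        [set S : {set V} | [&& S \subset M, independent e (v |: S)
                             & [exists u, dominates e u (v |: S)]]]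
  | _ => [set set0]
  end.

(* The polynomial variables: [inl u] stands for x_u and [inr p] for z_p. *)
Definition var (V : finType) (M : {set V}) (l : nat) : finType :=
  ({u : V | u \in M} + Bedge M l)%type.

Definition xvar (V : finType) (M : {set V}) (l : nat)
    (u : {u : V | u \in M}) : 'I_#|var M l| :=
  enum_rank (inl u : var M l).

Definition zvar (V : finType) (M : {set V}) (l : nat)
    (p : Bedge M l) : 'I_#|var M l| :=
  enum_rank (inr p : var M l).

Definition edge_poly (R : realType) (V : finType) (e : rel V) (M : {set V})
    (l : nat) (p : Brow M l * Bcol M l) : {mpoly R[#|var M l|]} :=
  \sum_(S in edge_family e p)
    \prod_(s : {u : V | u \in M} | val s \in S) 'X_(xvar l s).

Definition edge_entry (R : realType) (V : finType) (e : rel V) (M : {set V})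
    (l : nat) (p : Brow M l * Bcol M l) : {mpoly R[#|var M l|]} :=
  if insub p is Some q then 'X_(zvar (q : Bedge M l)) * edge_poly R e p else 0.

Lemma card_Brow (V : finType) (M : {set V}) (l : nat) :
  (#|V| <= l + #|M|)%N -> (l + #|M|)%N = #|Brow M l|.
Proof. by move=> h; rewrite card_sum card_ord subnKC. Qed.

Lemma card_Bcol (V : finType) (M : {set V}) (l : nat) :
  (l + #|M|)%N = #|Bcol M l|.
Proof. by rewrite card_sum card_ord card_sig. Qed.

(* Rows and columns are listed in the order of their enumerations; another
   choice changes the determinant at most by a sign. *)
Definition edge_matrix (R : realType) (V : finType) (e : rel V) (M : {set V})
    (l : nat) (h : (#|V| <= l + #|M|)%N) :
    'M[{mpoly R[#|var M l|]}]_(l + #|M|) :=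
  \matrix_(i, j) edge_entry R e (enum_val (cast_ord (card_Brow h) i),
                                 enum_val (cast_ord (card_Bcol M l) j)).

(* The exponent vector of the product of all x_u *)
Definition all_x (V : finType) (M : {set V}) (l : nat) : 'X_{1..#|var M l|} :=
  (\sum_(u : {u : V | u \in M}) U_(xvar l u))%MM.

(* Main.v *)
(** Expand the determinant into signed monomials, one for each perfect matching
    of [B] together with a choice of a member of the family of each matching
    edge.  The [z]-part of a monomial determines the matching, so all
    occurrences of a given monomial carry the same sign and nothing cancels.
    Hence a monomial divisible by every [x_u] exists iff some perfect matching
    has chosen sets covering [M].  Such a cover yields a CD coloring by giving
    each vertex a color whose chosen set (with the matched vertex added)
    contains it.  Conversely, match each color of a CD coloring with a
    representative of its class, namely the unique vertex outside [M] if there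
    is one, and choose the trace of the class on [M]. *)
Require Import Defs.
From mathcomp Require Import all_boot all_order all_algebra.
From mathcomp Require Import perm reals.
From mathcomp Require Import mpoly.

Set Implicit Arguments.
Unset Strict Implicit.
Unset Printing Implicit Defensive.

Import Order.TTheory GRing.Theory Num.Theory.

Local Open Scope ring_scope.

Section DetOfMonomialSums.
Variables (R : numDomainType) (n N : nat) (T : finType).
Variables (F : 'I_n -> 'I_n -> {set T}) (w : 'I_n -> 'I_n -> T -> 'X_{1..N}).

Definition transversal_mnm (s : 'S_n) (g : 'I_n -> T) : 'X_{1..N} :=
  (\sum_i w i (s i) (g i))%MM.

Lemma msupp_det_sum_monomials (A : 'M[{mpoly R[N]}]_n) :
  (forall i j, A i j = \sum_(S in F i j) 'X_[w i j S]) ->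
  (forall (s t : 'S_n) g h, (forall i, g i \in F i (s i)) ->
     (forall i, h i \in F i (t i)) ->
     transversal_mnm s g = transversal_mnm t h -> s = t) ->
  forall m, m \in msupp (\det A) <->
    exists s : 'S_n, exists2 g : 'I_n -> T,
      forall i, g i \in F i (s i) & m = transversal_mnm s g.
Proof.
move=> AE sep m.
pose fam (s : 'S_n) :=
  [set g : {ffun 'I_n -> T} | [forall i, g i \in F i (s i)]].
have detE : (\det A)@_m =
    \sum_(s : 'S_n) (-1) ^+ s *
      \sum_(g in fam s) (transversal_mnm s g == m)%:R.
  rewrite /determinant raddf_sum /=; apply: eq_bigr => s _.
  have -> : \prod_i A i (s i) =
      \sum_(g in fam s) 'X_[R, transversal_mnm s g].
    under eq_bigr => i _ do rewrite AE.
    rewrite bigA_distr_big_dep; apply: eq_big => [g|g _].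
      by rewrite [RHS]inE; apply/familyP/forallP.
    by rewrite mprodXE.
  rewrite -signr_odd mulr_sign [in RHS]mulr_sign.
  have sumE : (\sum_(g in fam s) 'X_[R, transversal_mnm s g])@_m =
      \sum_(g in fam s) (transversal_mnm s g == m)%:R.
    by rewrite raddf_sum /=; apply: eq_bigr => g _; rewrite mcoeffX.
  by case: (s : bool); rewrite /= ?raddfN /= sumE.
rewrite mcoeff_msupp detE; split=> [nz|[s [g gF mE]]].
  have /existsP[s /existsP[g /andP[gs /eqP <-]]] :
      [exists s, exists g in fam s, transversal_mnm s g == m].
    apply: contraNT nz => /existsPn none; apply/eqP/big1 => s _.
    rewrite big1 ?mulr0 // => g gs.
    by have /existsPn/(_ g) := none s; rewrite gs /= => /negbTE->.
  by exists s, g => //; move: gs; rewrite inE => /forallP.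
pose g' := [ffun i => g i].
have g's : g' \in fam s by rewrite inE; apply/forallP=> i; rewrite ffunE.
have g'm : transversal_mnm s g' = m.
  by rewrite mE; apply: eq_bigr => i _; rewrite ffunE.
rewrite (bigD1 s) //= [X in _ + X]big1 ?addr0 => [|t t_neq]; last first.
  rewrite big1 ?mulr0 // => h; rewrite inE => /forallP ht.
  case: eqP => // hm; case/eqP: t_neq.
  by apply: (sep t s h g) => //; rewrite hm.
rewrite mulf_neq0 ?signr_eq0 // (bigD1 g') //= g'm eqxx.
rewrite gt_eqF // ltr_wpDr ?ltr01 //; apply: sumr_ge0 => h _.
exact: ler0n.
Qed.

End DetOfMonomialSums.

Lemma extend_injection (aT rT : finType) (d : nat) (h : aT -> rT) :
  injective h -> d = (#|rT| - #|aT|)%N ->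
  exists2 f : aT + 'I_d -> rT, injective f & forall x, f (inl x) = h x.
Proof.
move=> h_inj dE; pose C := ~: (h @: aT).
have dC : d = #|C|.
  by rewrite dE -(card_imset _ h_inj) -(cardsC (h @: aT)) addKn.
exists (fun x => match x with
  | inl x => h x | inr j => enum_val (cast_ord dC j) end) => //.
have outC j x : enum_val (cast_ord dC j) <> h x.
  by move=> jx; have := enum_valP (cast_ord dC j); rewrite jx inE imset_f.
move=> [x|i] [y|j] //=.
- by move=> /h_inj->.
- by move=> /esym/outC.
- by move=> /outC.
- by move=> /enum_val_inj/cast_ord_inj->.
Qed.

Section IndependentDominated.
Variables (V : finType) (e : rel V).

Lemma independentS (A B : {set V}) :
  A \subset B -> independent e B -> independent e A.
Proof.
move=> /subsetP AB /forall_inP indB; apply/forall_inP => u /AB uB.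
by apply/forall_inP => v /AB; apply: (forall_inP (indB u uB)).
Qed.

Lemma dominatesS u (A B : {set V}) :
  A \subset B -> dominates e u B -> dominates e u A.
Proof. exact: subset_trans. Qed.

End IndependentDominated.

Section Matching.
Variables (V : finType) (e : rel V) (M : {set V}) (l : nat).

Definition covering_matching (f : Brow M l -> Bcol M l)
    (g : Brow M l -> {set V}) : Prop :=
  [/\ injective f, forall r, Badj (r, f r),
      forall r, g r \in edge_family e (r, f r)
    & forall u, u \in M -> exists r, u \in g r].

Lemma CD_colorable_of_covering f g :
  covering_matching f g -> CD_colorable e l.
Proof.
move=> [f_inj fadj gfam gcov].
pose block v := if v \in M then g (inl v) else v |: g (inl v).
have blockP v c : f (inl v) = inl c ->
    independent e (block v) /\ exists u, dominates e u (block v).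
  move=> fv; have := gfam (inl v); rewrite fv /= /block.
  case: ifP => _; rewrite inE.
    by case/and4P=> _ ? _ /existsP.
  by case/and3P=> _ ? /existsP.
have cover u : exists v, exists2 c, f (inl v) = inl c & u \in block v.
  have [uM|uM] := boolP (u \in M).
    have [r ur] := gcov u uM; have := gfam r.
    case: r ur => [v|j] ur /=; last by rewrite inE => /eqP gj; rewrite gj inE in ur.
    case fv: (f (inl v)) => [c|y].
      by move=> _; exists v, c => //; rewrite /block; case: ifP; rewrite ?inE ?ur ?orbT.
    by rewrite inE => /eqP gv; rewrite gv inE in ur.
  exists u; have := fadj (inl u); case fu: (f (inl u)) => [c|y] /=.
    by exists c => //; rewrite /block (negbTE uM) setU11.
  by move=> /eqP uy; case/negP: uM; rewrite uy (valP y).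
pose good u (p : V * 'I_l) := (f (inl p.1) == inl p.2) && (u \in block p.1).
have good_ex u : exists p, good u p.
  by have [v [c fv uv]] := cover u; exists (v, c); rewrite /good /= fv eqxx.
pose ch u := xchoose (good_ex u).
have chP u : f (inl (ch u).1) = inl (ch u).2 /\ u \in block (ch u).1.
  by have /andP[/eqP] := xchooseP (good_ex u).
have same u v : (ch u).2 = (ch v).2 -> (ch u).1 = (ch v).1.
  have [[fu _] [fv _]] := (chP u, chP v).
  by move=> uv; move: fu; rewrite uv -fv => /f_inj[].
exists (fun u => (ch u).2); split.
  move=> u v; apply: contraTneq => uv.
  have [[fu bu] [_ bv]] := (chP u, chP v).
  have [/forall_inP ind _] := blockP _ _ fu.
  by apply: (forall_inP (ind u bu)); rewrite (same u v).
move=> _ /codomP[u ->]; have [fu _] := chP u.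
have [_ [x domx]] := blockP _ _ fu; exists x; apply: dominatesS domx.
apply/subsetP => v; rewrite inE => /eqP vu.
by rewrite -(same v u) //; case: (chP v).
Qed.

Lemma covering_of_CD_colorable :
  clique e (~: M) -> CD_colorable e l -> exists f g, covering_matching f g.
Proof.
move=> Q_clique [col [proper dom]].
pose rep c := if [pick v | (col v == c) && (v \notin M)] is Some v then Some v
              else [pick v | col v == c].
have rep_col u : exists2 v, rep (col u) = Some v & col v = col u.
  rewrite /rep; case: pickP => [v /andP[/eqP cv _]|_]; first by exists v.
  by case: pickP => [v /eqP cv|/(_ u)]; [exists v | rewrite eqxx].
have repQ v : v \notin M -> rep (col v) = Some v.
  move=> vQ; rewrite /rep; case: pickP => [u /andP[/eqP cu uQ]|/(_ v)].
    congr Some; apply/eqP/negPn/negP => uv.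
    have /proper : e u v by apply: Q_clique; rewrite ?inE.
    by rewrite cu eqxx.
  by rewrite eqxx vQ.
pose h v : Bcol M l :=
  if rep (col v) == Some v then inl (col v)
  else if insub v is Some y then inr y else inl (col v).
have hP v : (h v = inl (col v) /\ rep (col v) = Some v) \/
    exists2 y : {u : V | u \in M}, h v = inr y & val y = v.
  rewrite /h; case: eqP => [|nrep]; first by left.
  case: insubP => [y _ yv|vQ]; first by right; exists y.
  by case: nrep; rewrite repQ.
have h_inj : injective h.
  move=> u v; have [[-> ru]|[y -> yu]] := hP u; have [[-> rv]|[z -> zv]] := hP v => //.
    by case=> cuv; apply: Some_inj; rewrite -ru cuv.
  by case=> yz; rewrite -yu yz.
have dE : (l + #|M| - #|V| = #|Bcol M l| - #|V|)%N by rewrite -card_Bcol.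
have [f f_inj fE] := extend_injection h_inj dE.
pose cls c := [set w | col w == c].
have cls_ind c : independent e (cls c).
  apply/forall_inP => u; rewrite inE => /eqP uc; apply/forall_inP => v.
  by rewrite inE => /eqP vc; apply/negP => /proper; rewrite uc vc eqxx.
pose g (r : Brow M l) := match r, f r with
  | inl v, inl _ => cls (col v) :&: M | _, _ => set0 end.
exists f, g; split=> //.
- case=> [v|//]; rewrite fE; have [[->]//|[y -> <-]] := hP v.
  exact: eqxx.
- case=> [v|j]; last by rewrite /= inE.
  rewrite /g fE; have [[-> rv]|[y -> _]] := hP v; last by rewrite /= inE.
  have [x domx] := dom (col v) (codom_f _ _).
  rewrite /=; case: ifPn => vM; rewrite inE subsetIr /=.
    rewrite (independentS _ (cls_ind (col v))) ?subsetIl // !inE eqxx vM /=.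
    by apply/existsP; exists x; apply: dominatesS domx; rewrite subsetIl.
  have sub : v |: cls (col v) :&: M \subset cls (col v).
    by rewrite subUset sub1set inE eqxx subsetIl.
  rewrite (independentS sub) //=.
  by apply/existsP; exists x; apply: dominatesS domx.
- move=> u uM; have [v rv cv] := rep_col u; exists (inl v).
  by rewrite /g fE /h cv rv eqxx !inE eqxx uM.
Qed.

End Matching.

Section EdgeMatrix.
Variables (R : realType) (V : finType) (e : rel V) (M : {set V}) (l : nat).
Implicit Type p : Brow M l * Bcol M l.

Definition edge_choices p : {set {set V}} :=
  if Badj p then edge_family e p else set0.

Definition edge_mnm p (S : {set V}) : 'X_{1..#|var M l|} :=
  ((if insub p is Some q then U_(zvar (q : Bedge M l)) else 0) +
   \sum_(s : {u : V | u \in M} | val s \in S) U_(xvar l s))%MM.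

Lemma edge_entryE p :
  edge_entry R e p = \sum_(S in edge_choices p) 'X_[edge_mnm p S].
Proof.
rewrite /edge_entry /edge_choices /edge_mnm.
case: insubP => [q -> _|/negbTE->]; last by rewrite big_set0.
rewrite /edge_poly mulr_sumr; apply: eq_bigr => S _.
by rewrite mprodXE mpolyXD.
Qed.

Lemma edge_mnm_z p S (q : Bedge M l) :
  edge_mnm p S (zvar q) = (p == val q) :> nat.
Proof.
rewrite mnmDE mnm_sumE big1 => [|s _]; last first.
  by rewrite mnm1E (inj_eq enum_rank_inj).
rewrite addn0; case: insubP => [q' _ <-|pN].
  by rewrite mnm1E (inj_eq enum_rank_inj) (inj_eq val_inj).
by rewrite mnm0E; case: eqP => // pq; rewrite pq (valP q) in pN.
Qed.

Lemma edge_mnm_x p S (u : {u : V | u \in M}) :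
  edge_mnm p S (xvar l u) = (val u \in S) :> nat.
Proof.
rewrite mnmDE mnm_sumE.
have -> : (if insub p is Some q then U_(zvar (q : Bedge M l)) else 0)%MM
    (xvar l u) = 0%N.
  by case: insubP => [q _ _|_]; rewrite ?mnm0E // mnm1E (inj_eq enum_rank_inj).
rewrite add0n (eq_bigr (fun s => nat_of_bool (s == u))) => [|s _]; last first.
  by rewrite mnm1E (inj_eq enum_rank_inj).
have [uS|uS] := boolP (val u \in S).
  by rewrite (bigD1 u) //= eqxx big1 // => s /andP[_ /negbTE->].
by rewrite big1 // => s; case: eqP => // ->; rewrite (negbTE uS).
Qed.

Lemma all_xE (u : {u : V | u \in M}) : all_x M l (xvar l u) = 1%N.
Proof.
rewrite mnm_sumE (bigD1 u) //= mnm1E eqxx big1 // => s su.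
by rewrite mnm1E (inj_eq enum_rank_inj) eqE /= (negbTE su).
Qed.

Lemma all_x_leP (m : 'X_{1..#|var M l|}) :
  reflect (forall u, 0 < m (xvar l u))%N (all_x M l <= m)%MM.
Proof.
apply: (iffP mnm_lepP) => [le u|pos i].
  by rewrite -(all_xE u).
rewrite -(enum_valK i); case: (enum_val i) => [u|q].
  by rewrite all_xE; apply: pos.
by rewrite mnm_sumE big1 // => s _; rewrite mnm1E (inj_eq enum_rank_inj).
Qed.

Variable n_le : (#|V| <= l + #|M|)%N.

Let row_of (i : 'I_(l + #|M|)) : Brow M l := enum_val (cast_ord (card_Brow n_le) i).
Let col_of (j : 'I_(l + #|M|)) : Bcol M l := enum_val (cast_ord (card_Bcol M l) j).
Let row_idx (r : Brow M l) := cast_ord (esym (card_Brow n_le)) (enum_rank r).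
Let col_idx (c : Bcol M l) := cast_ord (esym (card_Bcol M l)) (enum_rank c).

Let row_ofK : cancel row_of row_idx.
Proof. by move=> i; rewrite /row_idx /row_of enum_valK cast_ordK. Qed.
Let row_idxK : cancel row_idx row_of.
Proof. by move=> r; rewrite /row_idx /row_of cast_ordKV enum_rankK. Qed.
Let col_ofK : cancel col_of col_idx.
Proof. by move=> i; rewrite /col_idx /col_of enum_valK cast_ordK. Qed.
Let col_idxK : cancel col_idx col_of.
Proof. by move=> r; rewrite /col_idx /col_of cast_ordKV enum_rankK. Qed.

Lemma msupp_det_edge_matrixP m :
  m \in msupp (\det (edge_matrix R e n_le)) <->
  exists s : 'S_(l + #|M|), exists2 g : 'I_(l + #|M|) -> {set V},
    forall i, g i \in edge_choices (row_of i, col_of (s i))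
    & m = (\sum_i edge_mnm (row_of i, col_of (s i)) (g i))%MM.
Proof.
apply: (@msupp_det_sum_monomials R _ _ _
  (fun i j => edge_choices (row_of i, col_of j))
  (fun i j => edge_mnm (row_of i, col_of j))).
  by move=> i j; rewrite mxE edge_entryE.
move=> s t g h gs _ st; apply/permP => i.
have adj : Badj (row_of i, col_of (s i)).
  by move: (gs i); rewrite /edge_choices; case: Badj => //; rewrite inE.
have := congr1 (fun m : 'X_{1..#|var M l|} => m (zvar (Sub _ adj))) st.
rewrite !mnm_sumE; under eq_bigr do rewrite edge_mnm_z.
under [in RHS]eq_bigr do rewrite edge_mnm_z.
rewrite (bigD1 i) //= eqxx => eq1.
have /existsP[j /eqP[/(can_inj row_ofK) ji /(can_inj col_ofK)]] :
    [exists j, (row_of j, col_of (t j)) == (row_of i, col_of (s i))].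
  by apply: contraPT eq1 => /existsPn none; rewrite [in RHS]big1 // => j _; rewrite (negbTE (none j)).
by rewrite ji => ->.
Qed.

Lemma all_x_msupp_det_edge_matrixP :
  (exists2 m, m \in msupp (\det (edge_matrix R e n_le)) & (all_x M l <= m)%MM)
  <-> exists f g, @covering_matching V e M l f g.
Proof.
split=> [[m /msupp_det_edge_matrixP[s [g gF ->]] /all_x_leP pos]|].
  have adj i : Badj (row_of i, col_of (s i)).
    by move: (gF i); rewrite /edge_choices; case: Badj => //; rewrite inE.
  exists (fun r => col_of (s (row_idx r))), (fun r => g (row_idx r)); split.
  - move=> x y /(can_inj col_ofK)/perm_inj.
    exact: can_inj row_idxK _ _.
  - by move=> r; rewrite -{1}(row_idxK r).
  - move=> r; have := gF (row_idx r).
    by rewrite /edge_choices adj row_idxK.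
  - move=> u uM; have := pos (Sub u uM).
    rewrite mnm_sumE lt0n sum_nat_eq0 negb_forall => /existsP[i].
    rewrite edge_mnm_x SubK eqb0 negbK => ui.
    by exists (row_of i); rewrite row_ofK.
move=> [f [g [f_inj adj gF gcov]]].
pose sf i := col_idx (f (row_of i)).
have sf_inj : injective sf.
  by move=> i j /(can_inj col_idxK)/f_inj/(can_inj row_ofK).
exists (\sum_i edge_mnm (row_of i, col_of (perm sf_inj i)) (g (row_of i)))%MM.
  apply/msupp_det_edge_matrixP; exists (perm sf_inj), (fun i => g (row_of i)) => //.
  by move=> i; rewrite permE /sf col_idxK /edge_choices adj.
apply/all_x_leP => u; have [r ur] := gcov _ (valP u).
by rewrite mnm_sumE (bigD1 (row_idx r)) //= edge_mnm_x row_idxK ur.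
Qed.

End EdgeMatrix.

Theorem theorem7 (R : realType) (V : finType) (e : rel V)
  (e_sym : ssrbool.symmetric e) (e_irr : irreflexive e)
  (l : nat) (l_gt0 : (0 < l)%N) (M : {set V})
  (Q_clique : clique e (~: M)) (n_le : (#|V| <= l + #|M|)%N) :
  CD_colorable e l <->
  exists2 m, m \in msupp (\det (edge_matrix R e n_le)) & (all_x M l <= m)%MM.
Proof.
rewrite all_x_msupp_det_edge_matrixP; split.
  exact: covering_of_CD_colorable.
by move=> [f [g]]; apply: CD_colorable_of_covering.
Qed.
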